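(* (i) For each integer $d\ge 2$, there is a graph $G$ with degeneracy $\delta^\star(G)=d$ and $\chi_\ell^\bullet(G)\ge d+2$. (ii) For each integer $k\ge 2$, there is a graph $G$ with $\chi_c^\bullet(G)=k+1$ and $\chi_c^\star(G)=2k$. (iii) There is a connected $3$-regular graph $G\ne K_4$ such that $\chi_\ell^\star(G)\ge \chi_\ell^\bullet(G)=4$.
   Context: The degeneracy $\delta^\star(G)$ is the least $d$ such that every subgraph of $G$ has a vertex of degree at most $d$. A correspondence-cover of a graph $G$ is a pair $(L,H)$ where $H$ is a graph and $L:V(G)\to 2^{V(H)}$ is such that: the sets $L(v)$ partition $V(H)$; for distinct non-adjacent $u,v$ there are no edges of $H$ between $L(u)$ and $L(v)$; for $uv\in E(G)$ the edges of $H$ between $L(u)$ and $L(v)$ form a matching; each $L(v)$ induces a clique in $H$. It is $k$-fold if $|L(v)|=k$ for all $v$. A $k$-list-assignment $L$ assigns each vertex a set $L(v)\subseteq\mathbb{N}$ of size $k$; its list-cover has vertices $x_v$ ($v\in V(G)$, $x\in L(v)$), cliques on each $\{x_v:x\in L(v)\}$, and edges $x_ux_v$ for each $uv\in E(G)$ and $x\in L(u)\cap L(v)$. The list packing number $\chi_\ell^\star(G)$ (resp. correspondence packing number $\chi_c^\star(G)$) is the least $k$ such that every $k$-fold list-cover (resp. $k$-fold correspondence-cover) $H$ of $G$ has chromatic number $k$. The fractional list packing number $\chi_\ell^\bullet(G)$ (resp. fractional correspondence packing number $\chi_c^\bullet(G)$) is the least integer $k$ such that every $k$-fold list-cover (resp.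 correspondence-cover) $H$ of $G$ has fractional chromatic number $k$. *)

(* Defs.v *)
From HB Require Import structures.
From mathcomp Require Import all_boot all_order all_algebra finmap.

Set Implicit Arguments.
Unset Strict Implicit.
Unset Printing Implicit Defensive.

Import Order.TTheory GRing.Theory Num.Theory.

Record sgraph := SGraph {
  vertex :> finType;
  edge : rel vertex;
  edge_sym : symmetric edge;
  edge_irrefl : irreflexive edge }.
Arguments edge {_} _ _.

Definition least (P : nat -> Prop) (k : nat) : Prop :=
  P k /\ forall j, P j -> k <= j.

Definition degree (G : sgraph) (x : G) : nat := #|[set y | edge x y]|.

Definition regular (G : sgraph) (r : nat) : Prop := forall x : G, degree x = r.

Definition connected (G : sgraph) : Prop :=
  0 < #|G| /\ forall x y : G, connect edge x y.

Definition isomorphic (G H : sgraph) : Prop :=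
  exists2 f : G -> H, bijective f & forall x y, edge (f x) (f y) = edge x y.

Fact complete_sym n : symmetric (fun i j : 'I_n => i != j).
Proof. by move=> i j; rewrite eq_sym. Qed.
Fact complete_irrefl n : irreflexive (fun i j : 'I_n => i != j).
Proof. by move=> i; rewrite eqxx. Qed.
Definition complete_graph (n : nat) : sgraph :=
  SGraph (@complete_sym n) (@complete_irrefl n).

(* A subgraph, not necessarily induced, with vertex set S and edge relation F. *)
Definition subgraph (G : sgraph) (S : {set G}) (F : rel G) : Prop :=
  symmetric F /\ forall x y, F x y -> [/\ x \in S, y \in S & edge x y].

(* Only subgraphs with at least one vertex are considered. *)
Definition degeneracy (G : sgraph) : nat -> Prop :=
  least (fun d => forall (S : {set G}) (F : rel G), subgraph S F -> S != set0 ->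
    exists2 x, x \in S & #|[set y | F x y]| <= d).

Definition colorable (H : sgraph) (k : nat) : Prop :=
  exists c : H -> 'I_k, forall x y, edge x y -> c x != c y.

Definition chromatic_number (H : sgraph) : nat -> Prop := least (colorable H).

Definition independent (H : sgraph) (I : {set H}) : bool :=
  [forall x in I, forall y in I, ~~ edge x y].

(* Rational weights suffice: the linear program defining the fractional        *)
(* chromatic number has rational data, so its minimum is attained at a         *)
(* rational point.                                                             *)
Definition fractional_coloring (H : sgraph) (w : {set H} -> rat) : Prop :=
  (forall I, 0 <= w I)%R /\
  forall x, (1 <= \sum_(I : {set H} | independent I && (x \in I)) w I)%R.

Definition coloring_weight (H : sgraph) (w : {set H} -> rat) : rat :=
  (\sum_(I : {set H} | independent I) w I)%R.

Definition fractional_chromatic_number (H : sgraph) (q : rat) : Prop :=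
  (exists2 w : {set H} -> rat, fractional_coloring w & coloring_weight w = q) /\
  (forall w : {set H} -> rat, fractional_coloring w -> (q <= coloring_weight w)%R).

(* In the third clause u and v are interchangeable, so it bounds the number of *)
(* matching edges at each endpoint on both sides.                              *)
Definition correspondence_cover (G H : sgraph) (L : G -> {set H}) : Prop :=
  [/\ forall x : H, exists! v : G, x \in L v,
      forall u v : G, u != v -> ~~ edge u v ->
        forall x y, x \in L u -> y \in L v -> ~~ edge x y,
      forall u v : G, edge u v ->
        forall x, x \in L u -> #|[set y in L v | edge x y]| <= 1 &
      forall (v : G) x y, x \in L v -> y \in L v -> x != y -> edge x y].

Definition fold_correspondence_cover (k : nat) (G H : sgraph)
    (L : G -> {set H}) : Prop :=
  correspondence_cover L /\ forall v, #|L v| = k.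

Definition list_assignment (k : nat) (G : sgraph) (L : G -> {fset nat}) : Prop :=
  forall v, #|` L v|%fset = k.

Section ListCover.
Variables (G : sgraph) (L : G -> {fset nat}).

(* The vertex x_v is the dependent pair of v and x in L v. *)
Definition list_cover_edge : rel {v : G & L v} := fun p q =>
  if tag p == tag q then p != q
  else edge (tag p) (tag q) && (val (tagged p) == val (tagged q)).

Fact list_cover_sym : symmetric list_cover_edge.
Proof.
by move=> p q; rewrite /list_cover_edge (eq_sym (tag p)) (eq_sym p) edge_sym
  (eq_sym (val (tagged p))).
Qed.

Fact list_cover_irrefl : irreflexive list_cover_edge.
Proof. by move=> p; rewrite /list_cover_edge !eqxx. Qed.

Definition list_cover : sgraph := SGraph list_cover_sym list_cover_irrefl.
End ListCover.

(* In the packing numbers k ranges over positive integers, since the 0-fold    *)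
(* cover has no vertices and chromatic number 0.                               *)
Definition list_packing_number (G : sgraph) : nat -> Prop :=
  least (fun k => 0 < k /\ forall L : G -> {fset nat},
    list_assignment k L -> chromatic_number (list_cover L) k).

Definition correspondence_packing_number (G : sgraph) : nat -> Prop :=
  least (fun k => 0 < k /\ forall (H : sgraph) (L : G -> {set H}),
    fold_correspondence_cover k L -> chromatic_number H k).

Definition fractional_list_packing_number (G : sgraph) : nat -> Prop :=
  least (fun k => 0 < k /\ forall L : G -> {fset nat},
    list_assignment k L -> fractional_chromatic_number (list_cover L) k%:R%R).

Definition fractional_correspondence_packing_number (G : sgraph) : nat -> Prop :=
  least (fun k => 0 < k /\ forall (H : sgraph) (L : G -> {set H}),
    fold_correspondence_cover k L -> fractional_chromatic_number H k%:R%R).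

(* Main.v *)
Require Import Defs.
From mathcomp Require Import all_boot all_order all_algebra finmap.
From mathcomp Require Import fingroup perm zify.
From Stdlib Require Import Classical_Prop.

(* After extending the partial matchings of a correspondence cover to
   permutations, a cover of G is a family of permutations s u v of 'I_n, one for
   each edge, and a fractional coloring of weight n is a probability distribution
   on the independent transversals under which every color of every list is
   equally likely.

   (i) In a (d+1)-clique with common list X, all colors of X occur. A vertex w
   joined to all of the clique but q, with one color m of X renamed to x in its
   list, is therefore forced to x whenever q takes m; both events have
   probability 1/(d+1), so they coincide, and w copies q up to the renaming.
   Renaming two colors in each of d branches forces one color on a last vertex
   with probability 2/(d+1).

   (ii) The graph is K_{k,N} with N huge. For j < 2k and any k permutations of
   'I_j, some vertex on the large side sees the colors 0, ..., min(k,j)-1 blocked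
   in the first min(k,j) transversals, which leaves too few colors for them. For
   k+1 colors, color the small side independently and uniformly, and let each
   other vertex choose among its free colors by a rule equivariant under cyclic
   shifts.

   (iii) The graph consists of two copies of K_4 minus an edge, joined by two
   edges between the endpoints of the missing edges. For four colors, color these
   endpoints so that the two in a common copy are independent. Each of the two
   other vertices of a copy then has two options, equivariant under shifts, and a
   single coin decides for both: some matching between their options avoids all
   conflicts. *)

Set Implicit Arguments.
Unset Strict Implicit.
Unset Printing Implicit Defensive.

Import Order.TTheory GRing.Theory Num.Theory.

(** * Matchings and coordinates of covers *)

(** If [s] follows [R] as often as possible but misses [R x y], exchanging its values at [x] and at
    the preimage of [y] gains [x]. Nothing is lost: [R] being functional and injective, [s] followed
    it at neither point. *)
Lemma matching_extension n (R : rel 'I_n) :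
  (forall i j k, R i j -> R i k -> j = k) ->
  (forall i j k, R i k -> R j k -> i = j) ->
  exists s : 'S_n, forall i j, R i j -> s i = j.
Proof.
move=> Rf Rinj.
pose score (s : 'S_n) := #|[set i | R i (s i)]|.
case: (@arg_maxnP _ (1%g : 'S_n) xpredT score) => // s _ s_max.
exists s => x y Rxy; apply/eqP/negPn/negP => sxy.
pose z := (s^-1)%g y; have sz : s z = y by rewrite permKV.
have zx : z != x by apply: contraNneq sxy => <-; rewrite sz.
have /negP[] : ~~ (score (tperm x z * s)%g <= score s).
  rewrite -ltnNge; apply: proper_card; apply/properP; split.
    apply/subsetP=> i; rewrite !inE permM; case: tpermP => // -> Rs.
      by case/eqP: sxy; apply: Rf Rs Rxy.
    by case/eqP: zx; apply: Rinj Rxy; rewrite -sz.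
  exists x; rewrite !inE ?permM ?tpermL ?sz //.
  by apply: contra sxy => Rs; rewrite (Rf _ _ _ Rs Rxy).
exact: s_max.
Qed.

Lemma dirac_matching n k (R : rel 'I_n) :
  n <= k.*2 -> (forall i, k <= #|[set j | R i j]|) ->
  (forall j, k <= #|[set i | R i j]|) ->
  exists s : 'S_n, forall i, R i (s i).
Proof.
move=> le_n Rr Rc.
(* A permutation matching as many points as possible matches all of them: else
   composing it with a suitable transposition matches one more. *)
pose score (s : 'S_n) := #|[set i | R i (s i)]|.
case: (@arg_maxnP _ (1%g : 'S_n) xpredT score) => // s _ s_max.
exists s => x; apply/negPn/negP => sx.
pose J1 : {set 'I_n} := [set j | R x (s j)].
pose J2 : {set 'I_n} := [set j | R j (s x)].
have cJ1 : k <= #|J1|.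
  apply: leq_trans (Rr x) _; rewrite -(card_imset _ (@perm_inj _ s)).
  apply: subset_leq_card; apply/subsetP=> j; rewrite inE => Rxj.
  by apply/imsetP; exists ((s^-1)%g j); rewrite ?inE permKV.
(* Both sets have at least [k] points and avoid [x], so they meet among the other [n - 1 < 2k]
   points. A common point can exchange values with [x]. *)
have : 0 < #|J1 :&: J2|.
  have /subset_leq_card : J1 :|: J2 \subset [set~ x].
    by apply/subsetP=> j; rewrite !inE; apply: contraL => /eqP->; rewrite (negPf sx).
  rewrite cardsC1 card_ord lt0n => cU; apply/eqP => cI.
  have : k + k <= n.-1.
    by apply: leq_trans (leq_add cJ1 (Rc (s x))) _; rewrite -cardsUI cI addn0.
  have := ltn_ord x; lia.
case/card_gt0P => y; rewrite !inE => /andP[Rxy Ryx].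
have /negP[] : ~~ (score (tperm x y * s)%g <= score s).
  rewrite -ltnNge; apply: proper_card; apply/properP; split.
    by apply/subsetP=> i; rewrite !inE permM; case: tpermP => // ->.
  by exists x; rewrite !inE ?permM ?tpermL // (negPf sx).
exact: s_max.
Qed.

Section Covers.
Variables (G H : sgraph) (n : nat) (L : G -> {set H}).
Hypothesis coverL : fold_correspondence_cover n L.

Lemma cover_fiber_unique u v x : x \in L u -> x \in L v -> u = v.
Proof.
move=> xu xv; case: coverL => -[/(_ x)[w [_ uw]] _ _ _] _.
by rewrite -(uw u xu) (uw v).
Qed.

Lemma cover_fiber_exists x : exists v, x \in L v.
Proof. by case: coverL => -[/(_ x)[w [? _]] _ _ _] _; exists w. Qed.

Definition proper_selection (s : G -> G -> 'S_n) (f : G -> 'I_n) :=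
  forall u v, edge u v -> s u v (f u) != f v.

Definition matching_family (s : G -> G -> 'S_n) :=
  forall u v, s v u = (s u v)^-1%g.

Definition selection (e : G -> 'I_n -> H) (f : G -> 'I_n) : {set H} :=
  [set e v (f v) | v in G].

(** Lists are numbered and the matching along each edge is enlarged to a permutation. This only adds
    conflicts, so a selection proper for [s] is independent in [H]. *)
Lemma cover_coordinates :
  exists (s : G -> G -> 'S_n) (e : G -> 'I_n -> H),
  [/\ matching_family s,
      forall v i, e v i \in L v,
      forall v, injective (e v),
      forall v x, x \in L v -> exists i, x = e v i &
      forall f, proper_selection s f -> independent (selection e f)].
Proof.
have [[_ Hnadj Hmatch Hclique] Lcard] := coverL.
pose e v (i : 'I_n) : H := enum_val (cast_ord (esym (Lcard v)) i).
have eL v i : e v i \in L v by apply: enum_valP.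
have einj v : injective (e v) by move=> i j /enum_val_inj /cast_ord_inj.
have esurj v x : x \in L v -> exists i, x = e v i.
  move=> xv; exists (cast_ord (Lcard v) (enum_rank_in xv x)).
  by rewrite /e cast_ordK enum_rankK_in.
have half u v : exists s : 'S_n, edge u v ->
    forall i j, edge (e u i) (e v j) -> s i = j.
  case uv: (edge u v); last by exists 1%g.
  have le1 w z x : edge w z -> x \in L w -> forall y y', y \in L z ->
      y' \in L z -> edge x y -> edge x y' -> y = y'.
    move=> wz xw y y' yz y'z xy xy'; have := Hmatch _ _ wz _ xw.
    by move/card_le1_eqP; apply; rewrite !inE ?yz ?y'z ?xy ?xy'.
  have [] := @matching_extension n (fun i j => edge (e u i) (e v j)).
  - by move=> i j k ij ik; apply: (einj v); apply: (le1 _ _ (e u i) uv).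
  - move=> i j k; rewrite ![edge _ (e v k)]edge_sym => ij ik; apply: (einj u).
    by apply: (le1 v u (e v k)); rewrite // edge_sym.
  - by move=> s sE; exists s => _.
have [h hE] := @fin_all_exists _ _ _ (fun p : G * G => half p.1 p.2).
(* The permutation is chosen in one direction, fixed by an order on the vertices, and inverted for
   the other. *)
pose s u v := if enum_rank u < enum_rank v then h (u, v)
  else if enum_rank v < enum_rank u then (h (v, u))^-1%g else 1%g.
exists s, e; split=> //.
  by move=> u v; rewrite /s; case: ltngtP; rewrite ?invgK ?invg1.
move=> f sf; apply/forall_inP => _ /imsetP[u _ ->].
apply/forall_inP => _ /imsetP[v _ ->].
have [->|uv] := eqVneq u v; first by rewrite edge_irrefl.
have [adj|] := boolP (edge u v); last by move/(Hnadj u v uv); apply; apply: eL.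
apply: contra (sf _ _ adj) => he; rewrite /s; case: ltngtP => r.
- by rewrite (hE (u, v) adj _ _ he).
- rewrite edge_sym in adj; rewrite edge_sym in he.
  by rewrite -(hE (v, u) adj _ _ he) permK.
- by case/eqP: uv; apply: enum_rank_inj; apply: val_inj.
Qed.

Lemma in_selection (e : G -> 'I_n -> H) f v i :
  (forall v i, e v i \in L v) -> (forall v, injective (e v)) ->
  (e v i \in selection e f) = (f v == i).
Proof.
move=> eL einj; apply/imsetP/eqP => [[u _ evu]|<-]; last by exists v.
have uv : u = v by apply: (@cover_fiber_unique u v (e u (f u))); rewrite // -evu.
by move: evu; rewrite uv => /einj.
Qed.

Lemma clique_meet_le1 (I : {set H}) v : independent I -> #|I :&: L v| <= 1.
Proof.
move=> /forall_inP indI; apply/card_le1_eqP => x y.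
rewrite !inE => /andP[xI xv] /andP[yI yv]; apply/eqP/negPn/negP => xy.
have [[_ _ _ /(_ v x y xv yv) h] _] := coverL.
by have /forall_inP/(_ y yI)/negP[] := indI x xI; apply: h; rewrite eq_sym.
Qed.

(** * Fractional colorings of covers *)

Section FractionalColoring.
Local Open Scope ring_scope.

Lemma coloring_weight_fiber (w : {set H} -> rat) v :
  \sum_(x in L v) \sum_(I : {set H} | independent I && (x \in I)) w I =
  \sum_(I : {set H} | independent I) w I * #|I :&: L v|%:R.
Proof.
rewrite (exchange_big_dep (@independent H)) /=; last by move=> x I _ /andP[].
apply: eq_bigr => I indI; rewrite sumr_const -[LHS]mulr_natr; congr (_ * _%:R).
by apply: eq_card => x; rewrite !inE indI andbC.
Qed.

(** Double counting over [L v]: each of its [n] vertices is covered with weight at least 1, and an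
    independent set covers at most one of them. *)
Lemma coloring_weight_ge (w : {set H} -> rat) (v : G) :
  fractional_coloring w -> n%:R <= coloring_weight w.
Proof.
case=> w_ge0 cov; have := coloring_weight_fiber w v.
have <- : \sum_(x in L v) (1 : rat) = n%:R.
  by case: coverL => _ /(_ v) <-; rewrite sumr_const.
move=> e; apply: (@le_trans _ _ (\sum_(x in L v)
  \sum_(I : {set H} | independent I && (x \in I)) w I)); first exact: ler_sum.
rewrite e; apply: ler_sum => I indI; rewrite -[leRHS]mulr1.
by apply: ler_wpM2l; rewrite ?w_ge0 // lern1 clique_meet_le1.
Qed.

(** Weight [n] leaves no slack in the double count, so its inequalities are equalities term by
    term. *)
Lemma tight_coloring (w : {set H} -> rat) (v : G) :
  fractional_coloring w -> coloring_weight w = n%:R ->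
  (forall I, independent I -> 0 < w I -> #|I :&: L v| = 1%N) /\
  (forall x, x \in L v ->
     \sum_(I : {set H} | independent I && (x \in I)) w I = 1).
Proof.
move=> [w_ge0 cov] wn; have e := coloring_weight_fiber w v.
have e1 : \sum_(x in L v) (1 : rat) = n%:R.
  by case: coverL => _ /(_ v) <-; rewrite sumr_const.
have le1 : \sum_(x in L v) (1 : rat) <= \sum_(x in L v)
  \sum_(I : {set H} | independent I && (x \in I)) w I by apply: ler_sum.
have le2 I : independent I -> w I * #|I :&: L v|%:R <= w I.
  by move=> indI; rewrite -[leRHS]mulr1 ler_wpM2l ?w_ge0 // lern1 clique_meet_le1.
have le3 : \sum_(I : {set H} | independent I) w I * #|I :&: L v|%:R <=
  \sum_(I : {set H} | independent I) w I by apply: ler_sum.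
have eq1 : \sum_(x in L v) \sum_(I : {set H} | independent I && (x \in I)) w I
  = n%:R by apply/eqP; rewrite eq_le -{2}e1 le1 e -wn le3.
split.
- move=> I indI wI; apply/eqP; rewrite eqn_leq clique_meet_le1 //=.
  have : \sum_(J : {set H} | independent J) (w J - w J * #|J :&: L v|%:R) == 0.
    by rewrite sumrB -e eq1 -wn subrr.
  rewrite psumr_eq0 => [/allP/(_ I)|J /le2]; last by rewrite subr_ge0.
  rewrite mem_index_enum indI => /(_ isT); case: (#|_|) => //=.
  by rewrite mulr0 subr0 gt_eqF.
- move=> x xv; apply/eqP; rewrite -subr_eq0.
  have : \sum_(y in L v) (\sum_(I : {set H} | independent I && (y \in I)) w I - 1)
    == 0 by rewrite sumrB eq1 e1 subrr.
  rewrite psumr_eq0 => [/allP/(_ x)|y _]; last by rewrite subr_ge0.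
  by rewrite mem_index_enum xv => /(_ isT).
Qed.

Lemma fractional_coloring_family (T : finType) (I : T -> {set H}) :
  (0 < #|T|)%N -> (forall t, independent (I t)) ->
  (forall x, (#|[set t | x \in I t]| * n)%N = #|T|) ->
  exists2 w : {set H} -> rat, fractional_coloring w & coloring_weight w = n%:R.
Proof.
move=> T_gt0 indI cov; pose c : rat := n%:R / #|T|%:R.
have T_neq0 : #|T|%:R != 0 :> rat by rewrite pnatr_eq0 -lt0n.
pose w (J : {set H}) : rat := c * #|[set t | I t == J]|%:R.
have wE (P : pred {set H}) :
    \sum_(J : {set H} | P J) w J = c * #|[set t | P (I t)]|%:R.
  rewrite -mulr_sumr -natr_sum; congr (_ * _%:R).
  rewrite -sum1dep_card (partition_big I P) //; apply: eq_bigr => J PJ.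
  rewrite -sum1dep_card; apply: eq_bigl => t.
  by case: eqP => [->|]; rewrite ?PJ ?andbF.
exists w; first split.
- by move=> J; rewrite /w /c mulr_ge0 ?divr_ge0.
- move=> x; rewrite wE.
  have -> : [set t | independent (I t) && (x \in I t)] = [set t | x \in I t].
    by apply/setP=> t; rewrite !inE indI.
  by rewrite /c mulrAC -natrM mulnC cov divff.
rewrite /coloring_weight wE.
have -> : [set t | independent (I t)] = [set: T].
  by apply/setP=> t; rewrite !inE indI.
by rewrite cardsT /c divfK.
Qed.

End FractionalColoring.

End Covers.

(** * Packings by permutations *)

Definition balanced (T : finType) n (f : T -> 'I_n) :=
  forall i j, #|[set t | f t == i]| = #|[set t | f t == j]|.

Lemma balanced_card (T : finType) n (f : T -> 'I_n) i :
  balanced f -> #|[set t | f t == i]| * n = #|T|.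
Proof.
move=> fb; rewrite -[RHS]sum1_card (partition_big f xpredT) //=.
under eq_bigr => j _ do rewrite sum1dep_card (fb j i).
by rewrite sum_nat_const card_ord mulnC.
Qed.

(** Shifting by [j - i] embeds the fiber over [i] into the fiber over [j]. Colors are added modulo
    [n.+1]. *)
Lemma balanced_equivariant (T : finType) n (f : T -> 'I_n.+1)
    (sh : 'I_n.+1 -> T -> T) :
  (forall a, injective (sh a)) -> (forall a t, f (sh a t) = (f t + a)%R) ->
  balanced f.
Proof.
move=> sh_inj fsh.
have le i j : #|[set t | f t == i]| <= #|[set t | f t == j]|.
  rewrite -(card_imset _ (sh_inj (j - i)%R)); apply: subset_leq_card.
  apply/subsetP=> _ /imsetP[t + ->]; rewrite !inE fsh => /eqP->.
  by rewrite addrC subrK.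
by move=> i j; apply/eqP; rewrite eqn_leq !le.
Qed.

Lemma balanced_comp (T : finType) n (f : T -> 'I_n) (h : T -> T) :
  injective h -> balanced f -> balanced (f \o h).
Proof.
move=> h_inj fb.
have E i : #|[set t | f (h t) == i]| = #|[set t | f t == i]|.
  rewrite -(card_imset _ h_inj); apply: eq_card => t.
  apply/imsetP/idP => [[u + ->]|]; rewrite !inE // => fi.
  by have [g gK hK] := injF_bij h_inj; exists (g t); rewrite ?inE hK.
by move=> i j; rewrite !E.
Qed.

(** For fixed [i], the values [f v i] form an independent transversal; as each [f v] is a
    permutation, these [n] transversals partition the cover. *)
Definition packable (G : sgraph) n :=
  forall s : G -> G -> 'S_n, matching_family s ->
  exists f : G -> 'S_n, forall i, proper_selection s (fun v => f v i).

(** A finite family, repetitions allowed, stands for a distribution with rational probabilities. *)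
Definition fractionally_packable (G : sgraph) n :=
  forall s : G -> G -> 'S_n, matching_family s ->
  exists (T : finType) (f : T -> G -> 'I_n),
  [/\ 0 < #|T|, forall t, proper_selection s (f t) &
      forall v, balanced (fun t => f t v)].

Section PackableCovers.
Variables (G H : sgraph) (n : nat) (L : G -> {set H}).
Hypothesis coverL : fold_correspondence_cover n L.

Lemma packable_colorable : packable G n -> colorable H n.
Proof.
have [s [e [sV eL einj esurj indep]]] := cover_coordinates coverL.
move=> /(_ s sV)[f fP].
have class x : exists i, x \in selection e (fun v => f v i).
  have [v /esurj[i ->]] := cover_fiber_exists coverL x.
  by exists ((f v)^-1%g i); rewrite (in_selection coverL) // permKV.
have [c cP] := fin_all_exists class; exists c => x y xy.
apply/negP=> /eqP cxy; have := cP y; rewrite -cxy => yI.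
have /forall_inP/(_ x (cP x))/forall_inP/(_ y yI) := indep _ (fP (c x)).
by rewrite xy.
Qed.

Lemma colorable_chromatic (v : G) : colorable H n -> chromatic_number H n.
Proof.
move=> Hn; split=> // j [c cP]; rewrite -[j]card_ord.
have [[_ _ _ cl] Lc] := coverL; rewrite -(Lc v).
rewrite -(@card_in_imset _ _ c) ?max_card // => x y xv yv cxy.
by apply/eqP/negPn/negP => /(cl v x y xv yv)/cP; rewrite cxy eqxx.
Qed.

Lemma colorable_fractional (v : G) : 0 < n -> colorable H n ->
  fractional_chromatic_number H n%:R%R.
Proof.
move=> n_gt0 [c cP]; split; last first.
  by move=> w; apply: (coloring_weight_ge coverL v).
apply: (@fractional_coloring_family _ _ _ (fun i => [set x | c x == i])).
- by rewrite card_ord.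
- move=> i; apply/forall_inP => x; rewrite inE => /eqP cx.
  apply/forall_inP => y; rewrite inE => /eqP cy.
  by apply/negP => /cP; rewrite cx cy eqxx.
move=> x; rewrite card_ord (_ : [set _ | _] = [set c x]) ?cards1 ?mul1n //.
by apply/setP=> i; rewrite !inE eq_sym.
Qed.

Lemma fractionally_packable_fractional (v : G) : fractionally_packable G n ->
  fractional_chromatic_number H n%:R%R.
Proof.
have [s [e [sV eL einj esurj indep]]] := cover_coordinates coverL.
move=> /(_ s sV)[T [f [T_gt0 fP fb]]]; split; last first.
  by move=> w; apply: (coloring_weight_ge coverL v).
apply: (@fractional_coloring_family _ _ _ (fun t => selection e (f t))) => //.
  by move=> t; apply: indep.
move=> x; have [u /esurj[i ->]] := cover_fiber_exists coverL x.
rewrite -(balanced_card i (fb u)); congr (#|pred_of_set _| * _).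
by apply/setP=> t; rewrite !inE (in_selection coverL).
Qed.

End PackableCovers.

(** * Covers defined by permutations *)

Section PermCover.
Variables (G : sgraph) (n : nat) (s : G -> G -> 'S_n).
Hypothesis sV : matching_family s.

Definition perm_cover_edge : rel (G * 'I_n)%type := fun p q =>
  if p.1 == q.1 then p.2 != q.2
  else edge p.1 q.1 && (s p.1 q.1 p.2 == q.2).

Fact perm_cover_sym : symmetric perm_cover_edge.
Proof.
move=> [u i] [v j]; rewrite /perm_cover_edge /= eq_sym (eq_sym i) edge_sym.
by case: eqP => // _; rewrite (sV u v) -[in RHS](inj_eq (@perm_inj _ (s u v))) permKV eq_sym.
Qed.

Fact perm_cover_irrefl : irreflexive perm_cover_edge.
Proof. by move=> p; rewrite /perm_cover_edge !eqxx. Qed.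

Definition perm_cover : sgraph := SGraph perm_cover_sym perm_cover_irrefl.

Definition perm_cover_fiber (v : G) : {set perm_cover} := [set p | p.1 == v].

Lemma perm_cover_fold : fold_correspondence_cover n perm_cover_fiber.
Proof.
split; last first.
  move=> v; rewrite -[RHS]card_ord -(@card_imset _ _ (fun i : 'I_n => (v, i))).
    apply: eq_card => -[u i]; rewrite !inE /=; apply/eqP/imsetP => [->|[j _ []//]].
    by exists i.
  by move=> i j [].
split.
- by move=> p; exists p.1; split=> [|v]; rewrite inE // => /eqP.
- move=> u v uv nadj [u' i] [v' j]; rewrite !inE /= => /eqP-> /eqP->.
  by rewrite /edge /= /perm_cover_edge /= (negPf uv) (negPf nadj).
- move=> u v uv [u' i]; rewrite inE /= => /eqP->.
  apply/card_le1_eqP => -[v1 j] [v2 k]; rewrite !inE /= => /andP[/eqP-> h1].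
  case/andP=> /eqP-> h2; move: h1 h2; rewrite /edge /= /perm_cover_edge /=.
  case: eqP uv => [->|_ _]; first by rewrite edge_irrefl.
  by move=> /andP[_ /eqP->] /andP[_ /eqP->].
- move=> v [u i] [u' j]; rewrite !inE /= => /eqP-> /eqP->.
  by rewrite xpair_eqE eqxx /= /edge /= /perm_cover_edge /= eqxx.
Qed.

Lemma perm_cover_colorable : colorable perm_cover n ->
  exists f : G -> 'S_n, forall i, proper_selection s (fun v => f v i).
Proof.
case=> c cP; have c_inj v : injective (fun j => c (v, j)).
  move=> i j cij; apply/eqP/negPn/negP => ij.
  have : @edge perm_cover (v, i) (v, j) by rewrite /edge /= /perm_cover_edge /= eqxx.
  by move/cP; rewrite cij eqxx.
(* The coloring is bijective on each fiber; its inverse picks the vertex of color [i]. *)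
exists (fun v => (perm (c_inj v))^-1%g) => i u v uv; apply/negP => /eqP E.
set j := (perm (c_inj u))^-1%g i in E.
set k := (perm (c_inj v))^-1%g i in E.
have : @edge perm_cover (u, j) (v, k).
  rewrite /edge /= /perm_cover_edge /= uv E eqxx.
  by case: eqP uv => // ->; rewrite edge_irrefl.
move/cP/negP; apply; apply/eqP.
by rewrite -[LHS](permE (c_inj u)) -[RHS](permE (c_inj v)) !permKV.
Qed.

(** By tightness, any single independent set of positive weight meets every fiber exactly once. *)
Lemma perm_cover_fractional : 0 < n ->
  fractional_chromatic_number perm_cover n%:R%R ->
  exists f : G -> 'I_n, proper_selection s f.
Proof.
move=> n_gt0 [[w wP wn] _].
have [I indI wI] : exists2 I : {set perm_cover}, independent I & (0 < w I)%R.
  have [w_ge0 _] := wP.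
  have : (0 < coloring_weight w)%R by rewrite wn ltr0n.
  rewrite lt_def sumr_ge0 // andbT psumr_neq0 //.
  by case/hasP => I _ /andP[indI wI]; exists I.
have one v := (tight_coloring perm_cover_fold v wP wn).1 I indI wI.
have ex v : exists i, (v, i) \in I.
  have : 0 < #|I :&: perm_cover_fiber v| by rewrite one.
  case/card_gt0P => -[u i]; rewrite !inE /= => /andP[ui /eqP uv].
  by exists i; rewrite -uv.
have [f fP] := fin_all_exists ex; exists f => u v uv.
have /forall_inP/(_ _ (fP u))/forall_inP/(_ _ (fP v)) := indI.
rewrite /edge /= /perm_cover_edge /= uv.
by case: eqP uv => // ->; rewrite edge_irrefl.
Qed.

End PermCover.

(** Vertices are treated by increasing rank. At [v], each of at most [k] earlier neighbors excludes
    one color from every transversal and one transversal from every color, so at least [k] of the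
    [2k] choices remain on either side. *)
Lemma greedy_packing (G : sgraph) (r : G -> nat) k :
  (forall u v, edge u v -> r u != r v) ->
  (forall v, #|[set u | edge u v && (r u < r v)]| <= k) ->
  packable G (2 * k).
Proof.
move=> rE back s sV.
have ext m : exists f : G -> 'S_(2 * k), forall i u v,
    edge u v -> r u < m -> r v < m -> s u v (f u i) != f v i.
  elim: m => [|m [f fP]]; first by exists (fun=> 1%g).
  have next v : exists t : 'S_(2 * k), forall i u, edge u v ->
      r u < r v -> s u v (f u i) != t i.
    pose B := [set u | edge u v && (r u < r v)].
    have [] := @dirac_matching (2 * k) k
      (fun i j => [forall u in B, s u v (f u i) != j]).
    - lia.
    - move=> i; have : #|[set s u v (f u i) | u in B]| <= k.
        exact: leq_trans (leq_imset_card _ _) (back v).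
      move=> le_k; rewrite -(leq_add2l #|[set s u v (f u i) | u in B]|).
      apply: (@leq_trans (2 * k)); first lia.
      rewrite -[leqLHS]card_ord -(cardsC [set s u v (f u i) | u in B]) leq_add2l.
      apply: subset_leq_card; apply/subsetP=> j; rewrite !inE => nj.
      by apply/forall_inP=> u uB; apply: contraNneq nj => <-; apply: imset_f.
    - move=> j; pose F := [set (f u)^-1%g ((s u v)^-1%g j) | u in B].
      have : #|F| <= k by apply: leq_trans (leq_imset_card _ _) (back v).
      move=> le_k; rewrite -(leq_add2l #|F|).
      apply: (@leq_trans (2 * k)); first lia.
      rewrite -[leqLHS]card_ord -(cardsC F) leq_add2l.
      apply: subset_leq_card; apply/subsetP=> i; rewrite !inE => nj.
      apply/forall_inP=> u uB; apply: contraNneq nj => Ej.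
      by apply/imsetP; exists u; rewrite // -Ej !permK.
    move=> t tP; exists t => i u uv ruv.
    by have /forall_inP/(_ u) := tP i; apply; rewrite inE uv.
  have [g gP] := fin_all_exists next.
  (* Vertices of equal rank are not adjacent, so those of rank [m] are treated simultaneously. *)
  exists (fun v => if r v == m then g v else f v) => i u v uv.
  rewrite !ltnS => um vm; case: (r u =P m) => ru; case: (r v =P m) => rv.
  - by case/eqP: (rE _ _ uv); rewrite ru rv.
  - have lt_vu : r v < r u by rewrite ltn_neqAle ru vm andbT; apply/eqP.
    rewrite eq_sym -(inj_eq (@perm_inj _ (s v u))) (sV v u) permKV.
    by apply: gP => //; rewrite edge_sym.
  - by apply: gP => //; rewrite rv ltn_neqAle um andbT; apply/eqP.
  - by apply: fP => //; rewrite ltn_neqAle ?um ?vm andbT; apply/eqP.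
have [f fP] := ext (\max_v r v).+1; exists f => i u v uv.
by apply: fP; rewrite // ltnS leq_bigmax.
Qed.

(** * Uniform distributions on list colorings *)

Lemma least_exists (P : nat -> Prop) n : P n -> exists m, least P m.
Proof.
elim/ltn_ind: n => n IHn Pn.
have [[m [mn Pm]]|none] := classic (exists m, m < n /\ P m); first exact: IHn Pm.
exists n; split=> // m Pm; rewrite leqNgt; apply/negP => mn.
by apply: none; exists m.
Qed.

Section ListCovers.
Variables (G : sgraph) (n : nat) (L : G -> {fset nat}).
Hypothesis sizeL : list_assignment n L.

Definition list_cover_fiber (v : G) : {set list_cover L} := [set p | tag p == v].

Lemma list_cover_fold : fold_correspondence_cover n list_cover_fiber.
Proof.
split; last first.
  move=> v; rewrite -(sizeL v) cardfE.
  rewrite -(@card_imset _ (list_cover L) (Tagged (fun v => L v) : L v -> _)).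
    apply: eq_card => -[u x]; rewrite inE /=; apply/eqP/imsetP => [uv|[y _ []//]].
    by subst u; exists x.
  by move=> x y /eqP; rewrite eq_Tagged => /eqP.
split.
- by move=> p; exists (tag p); split=> [|v]; rewrite inE // => /eqP.
- move=> u v uv nadj [u' x] [v' y]; rewrite !inE /= => /eqP Eu /eqP Ev; subst u' v'.
  by rewrite /edge /= /list_cover_edge /= (negPf uv) (negPf nadj).
- move=> u v uv [u' x]; rewrite inE /= => /eqP Eu; subst u'.
  apply/card_le1_eqP => -[v1 y] [v2 z]; rewrite !inE /= => /andP[/eqP Ev h1].
  case/andP=> /eqP Ev' h2; subst v1 v2; move: h1 h2; rewrite /edge /= /list_cover_edge /=.
  have /negPf-> : u != v by apply: contraTneq uv => ->; rewrite edge_irrefl.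
  move=> /andP[_ /eqP xy] /andP[_ /eqP xz]; congr Tagged.
  by apply: val_inj; rewrite -[LHS]xz -[RHS]xy.
- move=> v [u x] [u' y]; rewrite !inE /= => /eqP Eu /eqP Eu'; subst u u'.
  by rewrite /edge /= /list_cover_edge /= eqxx.
Qed.

(* The total mass is n, so that every listed color gets the fraction 1/n. *)
Lemma fractional_list_colorings (v0 : G) :
  fractional_chromatic_number (list_cover L) n%:R%R ->
  exists (T : finType) (p : T -> rat) (f : T -> G -> nat),
  [/\ forall t, (0 < p t)%R,
      forall t v, f t v \in L v,
      forall t u v, edge u v -> f t u != f t v &
      forall v c, c \in L v -> (\sum_(t | f t v == c) p t = 1)%R].
Proof.
case=> -[w wP wn] _.
have tight v := tight_coloring list_cover_fold v wP wn.
(* The sample space is the support of [w]; by tightness its members meet each list exactly once. *)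
pose A := [set I : {set list_cover L} | independent I & (0 < w I)%R].
pose T : finType := {I in A}.
have tA (t : T) : independent (val t) /\ (0 < w (val t))%R.
  by have := valP t; rewrite inE => /andP.
have ex (tv : T * G) : exists c, exists2 x : L tv.2,
    Tagged (fun v => L v) x \in val tv.1 & c = val x.
  case: tv => t v /=; have [indt wt] := tA t.
  have : 0 < #|val t :&: list_cover_fiber v| by rewrite (tight v).1.
  case/card_gt0P => -[u x]; rewrite !inE /= => /andP[xt /eqP uv]; subst u.
  by exists (val x), x.
have [g gP] := fin_all_exists ex; pose f t v := g (t, v).
have fE t v (x : L v) : (f t v == val x) =
    ((Tagged (fun v => L v) x : list_cover L) \in val t).
  have [y yt fy] := gP (t, v); rewrite /f fy (inj_eq val_inj).
  apply/eqP/idP => [<- //|xt].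
  have [indt wt] := tA t.
  have := (tight v).1 _ indt wt => /eqP; rewrite eqn_leq => /andP[/card_le1_eqP le1 _].
  have := le1 (Tagged (fun v => L v) y) (Tagged (fun v => L v) x).
  rewrite !inE /= yt xt eqxx => /(_ isT isT) /eqP.
  by rewrite eq_Tagged => /eqP.
exists T, (fun t => w (val t)), f; split.
- by move=> t; have [] := tA t.
- by move=> t v; have [y _ fy] := gP (t, v); rewrite /f fy; apply: valP.
- move=> t u v uv; have [x xt fx] := gP (t, u); have [y yt fy] := gP (t, v).
  have [/forall_inP/(_ _ xt)/forall_inP/(_ _ yt) + _] := tA t.
  have /negPf uv' : u != v by apply: contraTneq uv => ->; rewrite edge_irrefl.
  by rewrite /edge /= /list_cover_edge /= uv uv' /f fx fy.
- move=> v c cv; pose x : L v := [` cv]%fset.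
  pose X : list_cover L := Tagged (fun v => L v) x.
  have xv : X \in list_cover_fiber v by rewrite inE.
  rewrite -((tight v).2 _ xv) (bigID (fun I : {set list_cover L} => 0 < w I)%R) /=.
  rewrite [X in (_ + X)%R]big1 ?addr0; last first.
    move=> I /andP[_]; rewrite lt_def wP.1 andbT negbK.
    by move/eqP.
  transitivity (\sum_(I in A | X \in I)
     w I)%R; last by apply: eq_bigl => I; rewrite inE andbAC.
  rewrite big_sub_cond.
  by apply: eq_bigl => t; rewrite -fE.
Qed.

End ListCovers.

Definition seq_list (s : seq nat) : {fset nat} := [fset c in s]%fset.

Lemma mem_seq_list s c : (c \in seq_list s) = (c \in s).
Proof. by rewrite in_fset. Qed.

Lemma card_seq_list s : uniq s -> #|` seq_list s|%fset = size s.
Proof. by move=> s_uniq; rewrite card_fseq undup_id. Qed.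

(* For j < r, the constant list assignment {0, ..., j-1} has no proper coloring. *)
Lemma clique_fractional_list (G : sgraph) r (q : 'I_r -> G) j :
  (forall a b, a != b -> edge (q a) (q b)) -> 0 < j ->
  (forall L : G -> {fset nat}, list_assignment j L ->
     fractional_chromatic_number (list_cover L) j%:R%R) -> r <= j.
Proof.
case: r q => // r q qE j_gt0 jP; pose L (v : G) := seq_list (iota 0 j).
have sizeL : list_assignment j L.
  by move=> v; rewrite card_seq_list ?iota_uniq // size_iota.
have [T [p [f [p_gt0 fL fE fp]]]] :=
  fractional_list_colorings sizeL (q ord0) (jP L sizeL).
have [t _] : exists t : T, true.
  apply/existsP; apply: contraT => /existsPn none.
  have := fp (q ord0) 0; rewrite /L mem_seq_list mem_iota j_gt0 => /(_ isT).
  by rewrite big1 // => t; have := none t.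
have inj : injective (fun a => f t (q a)).
  by move=> a b E; apply/eqP/negPn/negP => /qE /(fE t); rewrite E eqxx.
rewrite -[r.+1]size_enum_ord -(size_map (fun a => f t (q a))) -[j](size_iota 0).
apply: uniq_leq_size; first by rewrite map_inj_uniq // enum_uniq.
by move=> c /mapP[a _ ->]; have := fL t (q a); rewrite /L mem_seq_list.
Qed.

Lemma packable_list_packing (G : sgraph) (v : G) n : 0 < n -> packable G n ->
  0 < n /\ forall L : G -> {fset nat}, list_assignment n L ->
    chromatic_number (list_cover L) n.
Proof.
move=> n_gt0 pG; split=> // L sizeL; have fold := list_cover_fold sizeL.
exact: (colorable_chromatic fold v (packable_colorable fold pG)).
Qed.

Lemma list_packing_fractional (G : sgraph) (v : G) n :
  (0 < n /\ forall L : G -> {fset nat}, list_assignment n L ->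
    chromatic_number (list_cover L) n) ->
  0 < n /\ forall L : G -> {fset nat}, list_assignment n L ->
    fractional_chromatic_number (list_cover L) n%:R%R.
Proof.
case=> n_gt0 nP; split=> // L sizeL.
by apply: (colorable_fractional (list_cover_fold sizeL) v); have [] := nP L sizeL.
Qed.

(** * Forced renaming in degenerate graphs *)

(** In a subgraph, a vertex of maximal rank has only neighbors of lower rank, at most [d] of them.
    Conversely, all degrees in the clique [q] are [d]. *)
Lemma degeneracy_ordered (G : sgraph) (r : G -> nat) d (q : 'I_d.+1 -> G) :
  (forall u v, edge u v -> r u != r v) ->
  (forall v, #|[set u | edge v u && (r u < r v)]| <= d) ->
  injective q -> (forall a b, a != b -> edge (q a) (q b)) ->
  degeneracy G d.
Proof.
move=> rE back q_inj qE; split.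
  move=> S F [Fsym FE] /set0Pn[x0 x0S].
  have [x xS x_max] := arg_maxnP r x0S; exists x => //.
  apply: leq_trans (back x); apply: subset_leq_card; apply/subsetP=> y.
  rewrite !inE => /FE[_ yS xy]; rewrite xy /= ltn_neqAle eq_sym rE //=.
  exact: x_max.
move=> j jP; pose S := q @: setT.
pose F : rel G := fun x y => [&& x \in S, y \in S & edge x y].
have [||x /imsetP[a _ ->]] := jP S F.
- split; first by move=> x y; rewrite /F edge_sym andbCA.
  by move=> x y /and3P[].
- by apply/set0Pn; exists (q ord0); apply: imset_f.
apply: leq_trans; rewrite -[leqLHS]/(d.+1.-1) -{1}[d.+1]card_ord -(cardsC1 a).
rewrite -(card_imset _ q_inj); apply: subset_leq_card.
apply/subsetP=> _ /imsetP[b + ->]; rewrite !inE /F => ba.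
by rewrite !imset_f // qE // eq_sym.
Qed.

Section ListMeasure.
Variables (G : sgraph) (L : G -> {fset nat}).
Variables (T : finType) (p : T -> rat) (f : T -> G -> nat).
Hypothesis p_gt0 : forall t, (0 < p t)%R.
Hypothesis fL : forall t v, f t v \in L v.
Hypothesis fE : forall t u v, edge u v -> f t u != f t v.
Hypothesis fp : forall v c, c \in L v -> (\sum_(t | f t v == c) p t = 1)%R.

(** All points have positive mass, so the part of [Q] outside [P], of mass 0, is empty. *)
Lemma equal_mass_sub (P Q : pred T) : (forall t, P t -> Q t) ->
  (\sum_(t | P t) p t = \sum_(t | Q t) p t)%R -> forall t, Q t -> P t.
Proof.
move=> PQ; rewrite [RHS](bigID P) /= => /eqP.
have -> : (\sum_(t | Q t && P t) p t = \sum_(t | P t) p t)%R.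
  by apply: eq_bigl => t; case Pt: (P t); rewrite ?andbF // PQ.
rewrite eq_sym -subr_eq0 addrC addrK psumr_eq0 => [/allP zero t Qt|t _]; last exact: ltW.
apply: contraT => nPt; have := zero t (mem_index_enum t).
by rewrite Qt nPt gt_eqF.
Qed.

(* If q_0 uses m then w is forced to use x; as both events have mass 1, they
   coincide, and otherwise w is forced to copy q_0. *)
Lemma clique_rename d (q : 'I_d.+1 -> G) (w : G) (X : seq nat) m x :
  (forall a b, a != b -> edge (q a) (q b)) ->
  (forall a, a != ord0 -> edge w (q a)) ->
  size X = d.+1 -> (forall a, L (q a) =i X) ->
  m \in X -> x \in L w -> x \notin X ->
  (forall c, c \in L w -> c = x \/ c \in X /\ c != m) ->
  forall t, f t w = if f t (q ord0) == m then x else f t (q ord0).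
Proof.
move=> qE wE sizeX LX mX xw xX wL.
(* The clique takes [d.+1] distinct colors from [X], which has only that many. *)
have onto t c : c \in X -> exists a, f t (q a) = c.
  pose s := [seq f t (q a) | a <- enum 'I_d.+1].
  have inj : injective (fun a => f t (q a)).
    by move=> a b E; apply/eqP/negPn/negP => /qE /(fE t); rewrite E eqxx.
  have s_uniq : uniq s by rewrite map_inj_uniq ?enum_uniq.
  have sX : {subset s <= X} by move=> _ /mapP[a _ ->]; rewrite -(LX a).
  have [|_ sE] := uniq_min_size s_uniq sX; first by rewrite size_map size_enum_ord sizeX.
  by rewrite -sE => /mapP[a _ ->]; exists a.
have copy t : f t w \in X -> f t w = f t (q ord0).
  move=> /(onto t)[a fa]; have [a0|/wE/(fE t)] := eqVneq a ord0; first by rewrite -fa a0.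
  by rewrite fa eqxx.
have sub t : f t (q ord0) == m -> f t w == x.
  move=> /eqP q0m; have [-> //|[wX]] := wL _ (fL t w).
  by rewrite (copy t wX) q0m eqxx.
have sup := equal_mass_sub sub.
rewrite !fp ?LX // in sup; move/(_ erefl) in sup.
move=> t; case: ifP => [/sub/eqP //|/negbT q0m].
have [wx|[wX _]] := wL _ (fL t w); last exact: copy.
by rewrite sup ?wx in q0m.
Qed.

End ListMeasure.

Section RenamingGraph.
Variable d : nat.

(** In branch [i], the clique [base] without its vertex 0 is joined to vertex 0 of the clique
    [middle i], and the rest of [middle i] to [tip i]; [apex] is joined to all tips. So each branch
    can rename the color of [base ord0] twice. *)
Definition renaming_vertex : finType :=
  ('I_d.+1 + ('I_d * 'I_d.+1) + 'I_d + unit)%type.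

Definition base (j : 'I_d.+1) : renaming_vertex := inl (inl (inl j)).
Definition middle (i : 'I_d) (j : 'I_d.+1) : renaming_vertex :=
  inl (inl (inr (i, j))).
Definition tip (i : 'I_d) : renaming_vertex := inl (inr i).
Definition apex : renaming_vertex := inr tt.

Definition back_edge : rel renaming_vertex := fun x y =>
  match x, y with
  | inl (inl (inl j)), inl (inl (inl j')) => j' < j
  | inl (inl (inr (i, j))), inl (inl (inr (i', j'))) => (i == i') && (j' < j)
  | inl (inl (inr (i, j))), inl (inl (inl j')) => (j == ord0) && (j' != ord0)
  | inl (inr i), inl (inl (inr (i', j))) => (i == i') && (j != ord0)
  | inr _, inl (inr _) => true
  | _, _ => false
  end.

Definition rank (x : renaming_vertex) : nat :=
  match x with
  | inl (inl (inl j)) => j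
  | inl (inl (inr (_, j))) => d.+1 + j
  | inl (inr _) => (d.+1).*2
  | inr _ => (d.+1).*2.+1
  end.

Lemma back_edge_rank x y : back_edge x y -> rank y < rank x.
Proof.
case: x => [[[j|[i j]]|i]|[]]; case: y => [[[j'|[i' j']]|i']|[]] //=;
  move: (ltn_ord j') => //; lia.
Qed.

Definition renaming_edge : rel renaming_vertex :=
  fun x y => back_edge x y || back_edge y x.

Fact renaming_sym : symmetric renaming_edge.
Proof. by move=> x y; rewrite /renaming_edge orbC. Qed.

Fact renaming_irrefl : irreflexive renaming_edge.
Proof.
move=> x; rewrite /renaming_edge orbb; apply/negbTE/negP => /back_edge_rank.
by rewrite ltnn.
Qed.

Definition renaming_graph : sgraph := SGraph renaming_sym renaming_irrefl.

Lemma renaming_rank (u v : renaming_graph) : edge u v -> rank u != rank v.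
Proof. by case/orP => /back_edge_rank; case: ltngtP. Qed.

Lemma renaming_back_degree (v : renaming_graph) :
  #|[set u : renaming_graph | edge v u && (rank u < rank v)]| <= d.
Proof.
suff [g gP] : exists g : 'I_d -> renaming_vertex,
    forall u, back_edge v u -> exists i, u = g i.
  rewrite -[leqRHS]card_ord -cardsT; apply: leq_trans (leq_imset_card g setT).
  apply: subset_leq_card; apply/subsetP=> u; rewrite inE => /andP[/orP[|]].
    by case/gP=> i -> _; apply: imset_f.
  by move/back_edge_rank; case: ltngtP.
have low (j j' : 'I_d.+1) : j' < j -> exists i : 'I_d, j' = widen_ord (leqnSn d) i.
  move=> lt_j; have lt_d : j' < d by apply: leq_trans lt_j _; rewrite -ltnS.
  by exists (Ordinal lt_d); apply: val_inj.
have pos (j : 'I_d.+1) : j != ord0 -> exists i : 'I_d, j = lift ord0 i.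
  by rewrite eq_sym => /unlift_some[i]; exists i.
case: v => [[[j|[i j]]|i]|[]].
- exists (fun a => base (widen_ord (leqnSn d) a)).
  by case=> [[[j'|[i' j']]|i']|[]] //= /low[a ->]; exists a.
- have [->|j0] := eqVneq j ord0.
    exists (fun a => base (lift ord0 a)).
    case=> [[[j'|[i' j']]|i']|[]] //=; last by rewrite ltn0 andbF.
    by case/pos=> a ->; exists a.
  exists (fun a => middle i (widen_ord (leqnSn d) a)).
  case=> [[[j'|[i' j']]|i']|[]] //=; first by rewrite (negPf j0).
  by case/andP=> /eqP <- /low[a ->]; exists a.
- exists (fun a => middle i (lift ord0 a)).
  by case=> [[[j'|[i' j']]|i']|[]] //= /andP[/eqP <- /pos[a ->]]; exists a.
- by exists tip; case=> [[[j'|[i' j']]|i']|[]] //= _; exists i'.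
Qed.

Lemma base_clique a b : a != b -> @edge renaming_graph (base a) (base b).
Proof. by rewrite /edge /= /renaming_edge /= orbC -neq_ltn. Qed.

Lemma middle_clique i a b :
  a != b -> @edge renaming_graph (middle i a) (middle i b).
Proof. by rewrite /edge /= /renaming_edge /= eqxx /= orbC -neq_ltn. Qed.

Lemma renaming_degeneracy : degeneracy renaming_graph d.
Proof.
apply: (@degeneracy_ordered renaming_graph rank d base renaming_rank
  renaming_back_degree).
  by move=> a b [].
exact: base_clique.
Qed.

(* Along branch i the base color d becomes i and the base color d+1 becomes
   i+1 mod d; over all branches, both images exhaust {0, ..., d-1}. *)
Definition renaming_list (x : renaming_vertex) : seq nat :=
  match x with
  | inl (inl (inl _)) => iota d d.+1
  | inl (inl (inr (i, _))) => (i : nat) :: iota d.+1 d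
  | inl (inr i) => [:: (i : nat), i.+1 %% d & iota d.+2 d.-1]
  | inr _ => iota 0 d.+1
  end.

Hypothesis d_ge2 : 2 <= d.

Lemma succ_mod_neq (i : 'I_d) : i.+1 %% d != i.
Proof.
have [lt_i|] := ltnP i.+1 d; first by rewrite modn_small //; lia.
move=> le_d; have -> : i.+1 = d by have := ltn_ord i; lia.
by rewrite modnn; lia.
Qed.

Lemma succ_mod_lt (i : 'I_d) : i.+1 %% d < d.
Proof. by rewrite ltn_mod; lia. Qed.

Lemma renaming_list_assignment :
  list_assignment d.+1 (fun x : renaming_graph => seq_list (renaming_list x)).
Proof.
move=> v; rewrite card_seq_list.
  by case: v => [[[j|[i j]]|i]|[]] /=; rewrite size_iota //; lia.
case: v => [[[j|[i j]]|i]|[]]; rewrite /renaming_list ?iota_uniq //.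
  by rewrite cons_uniq iota_uniq mem_iota; have := ltn_ord i; lia.
rewrite !cons_uniq iota_uniq inE !mem_iota eq_sym (negPf (succ_mod_neq i)).
by have := ltn_ord i; have := succ_mod_lt i; lia.
Qed.

(** Colors [d] and [d+1] of [base ord0] have total mass 2, yet each of them puts all of 0, ..., d-1
    on the tips and so forces the color [d], of mass 1, on [apex]. *)
Lemma renaming_not_uniform :
  ~ fractional_chromatic_number
      (list_cover (fun x : renaming_graph => seq_list (renaming_list x)))
      d.+1%:R%R.
Proof.
case/(fractional_list_colorings renaming_list_assignment (apex : renaming_graph)).
move=> T [p [f [p_gt0 fL fE fp]]].
have middle0 i t : f t (middle i ord0) =
    if f t (base ord0) == d then nat_of_ord i else f t (base ord0).
  apply: (clique_rename p_gt0 fL fE fp (X := iota d d.+1) base_clique).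
  - by move=> a a0; rewrite /edge /= /renaming_edge /= ?eqxx a0.
  - by rewrite size_iota.
  - by move=> a c; rewrite mem_seq_list.
  - by rewrite mem_iota; lia.
  - by rewrite mem_seq_list inE eqxx.
  - by rewrite mem_iota; have := ltn_ord i; lia.
  - move=> c; rewrite mem_seq_list inE => /orP[/eqP|]; first by left.
    by rewrite !mem_iota => ?; right; lia.
have tips i t : f t (tip i) = if f t (middle i ord0) == d.+1 then i.+1 %% d
    else f t (middle i ord0).
  apply: (clique_rename p_gt0 fL fE fp (X := nat_of_ord i :: iota d.+1 d) (@middle_clique i)).
  - by move=> a a0; rewrite /edge /= /renaming_edge /= eqxx a0.
  - by rewrite /= size_iota.
  - by move=> a c; rewrite mem_seq_list.
  - by rewrite inE mem_iota; lia.
  - by rewrite mem_seq_list !inE eqxx orbT.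
  - by rewrite inE (negPf (succ_mod_neq i)) mem_iota; have := succ_mod_lt i; lia.
  - move=> c; rewrite mem_seq_list !inE => /or3P[/eqP->|/eqP|].
    + by right; rewrite eqxx; have := ltn_ord i; lia.
    + by left.
    + by rewrite !mem_iota => ?; right; lia.
have apexE t : (f t (base ord0) == d) || (f t (base ord0) == d.+1) ->
    f t apex == d.
  move=> b; have := fL t apex; rewrite mem_seq_list mem_iota add0n ltnS /=.
  rewrite leq_eqVlt => /orP[//|lt_c]; have tipE i : f t apex != f t (tip i) by apply: fE.
  case/orP: b => /eqP b.
    have := tipE (Ordinal lt_c); rewrite tips middle0 b eqxx /= ifN ?eqxx //.
    by rewrite neq_ltn; lia.
  (* The tip whose index cyclically precedes [f t apex] has been renamed to that very color. *)
  have lt_i : (f t apex + d.-1) %% d < d by rewrite ltn_mod; lia.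
  have := tipE (Ordinal lt_i); rewrite tips middle0 b (gtn_eqF (ltnSn d)) eqxx /=.
  rewrite -addn1 modnDml -addnA addn1 prednK; last lia.
  by rewrite modnDr modn_small // eqxx.
have : (\sum_(t | (f t (base ord0) == d) || (f t (base ord0) == d.+1)) p t <=
        \sum_(t | f t apex == d) p t)%R.
  rewrite big_mkcond [leRHS]big_mkcond; apply: ler_sum => t _.
  case: ifP => [/apexE -> //|_]; case: ifP => // _; exact: ltW.
rewrite fp; last by rewrite mem_seq_list mem_iota; lia.
rewrite (bigID (fun t => f t (base ord0) == d)) /=.
rewrite (eq_bigl (fun t => f t (base ord0) == d)); last by move=> t; case: eqP; rewrite ?andbF.
rewrite [X in (_ + X)%R](eq_bigl (fun t => f t (base ord0) == d.+1)); last first.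
  by move=> t; case: eqP => [->|]; rewrite ?andbF ?andbT //=; lia.
by rewrite !fp // mem_seq_list mem_iota; lia.
Qed.

End RenamingGraph.

(** A packing with [2 * d] colors shows that [m] exists. The clique gives [d + 1 <= m], and the list
    assignment above excludes equality. *)
Lemma degenerate_list_packing d : 2 <= d -> exists G : sgraph, degeneracy G d /\
  exists2 m : nat, fractional_list_packing_number G m & d + 2 <= m.
Proof.
move=> d_ge2; pose G := renaming_graph d; exists G.
split; first exact: renaming_degeneracy.
have v : G by apply: apex.
have pG : packable G (2 * d).
  apply: (@greedy_packing G (@rank d) d (@renaming_rank d)) => x.
  apply: leq_trans (renaming_back_degree x); apply: subset_leq_card.
  by apply/subsetP=> y; rewrite !inE edge_sym.
have [m mP] : exists m, fractional_list_packing_number G m.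
  apply: (@least_exists _ (2 * d)); apply: (list_packing_fractional v).
  by apply: (packable_list_packing v _ pG); lia.
exists m => //; have [[m_gt0 mL] _] := mP.
have := clique_fractional_list (@base_clique d) m_gt0 mL.
rewrite addn2 leq_eqVlt => /orP[/eqP dm|//].
by case: (renaming_not_uniform d_ge2); rewrite dm; apply: mL;
  rewrite -dm; apply: renaming_list_assignment.
Qed.

(** * Complete bipartite graphs *)

Section CompleteBipartite.
Variables k N : nat.

Definition bipartite_edge : rel ('I_k + 'I_N)%type := fun x y =>
  match x, y with inl _, inr _ | inr _, inl _ => true | _, _ => false end.

Fact bipartite_sym : symmetric bipartite_edge.
Proof. by case=> ? []. Qed.

Fact bipartite_irrefl : irreflexive bipartite_edge.
Proof. by case. Qed.

Definition complete_bipartite : sgraph := SGraph bipartite_sym bipartite_irrefl.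

Lemma complete_bipartite_packable : packable complete_bipartite (2 * k).
Proof.
apply: (@greedy_packing complete_bipartite
  (fun x : 'I_k + 'I_N => if x is inl _ then 0 else 1) k).
  by case=> ? [].
case=> [a|b].
  by rewrite (_ : [set _ | _] = set0) ?cards0 //; apply/setP=> u; rewrite !inE andbF.
rewrite -[leqRHS]card_ord -(card_imset _ (@inl_inj 'I_k 'I_N)).
apply: subset_leq_card; apply/subsetP=> -[a|b']; rewrite inE // => _.
exact: imset_f.
Qed.

End CompleteBipartite.

Lemma fractionally_packable_bipartite k N : 
  fractionally_packable (complete_bipartite k.+1 N) k.+2.
Proof.
move=> s sV.
pose T := {ffun 'I_k.+1 -> 'I_k.+2}.
(* The free color is sought relative to [t ord0], so the choice commutes with shifts. The default 0
   never occurs: [k.+1] vertices leave one of [k.+2] colors free. *)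
pose free (t : T) : 'I_k.+2 :=
  (t ord0 + odflt 0 [pick z | [forall a, t a != t ord0 + z]])%R.
have freeP (t : T) a : t a != free t.
  rewrite /free; case: pickP => [z /forallP/(_ a)//|none].
  have : #|[set t a | a : 'I_k.+1]| < #|'I_k.+2|.
    by rewrite [ltnRHS]card_ord ltnS -[leqRHS]card_ord leq_imset_card.
  rewrite ltnNge => /negP[]; apply: subset_leq_card; apply/subsetP=> c _.
  have /negbT := none (c - t ord0)%R; rewrite negb_forall => /existsP[b].
  by rewrite negbK addrC subrK => /eqP <-; apply: imset_f.
pose shift z (t : T) : T := [ffun a => t a + z]%R.
have shift_free z t : free (shift z t) = (free t + z)%R.
  rewrite /free ffunE -!addrA [in RHS](addrC _ z) !addrA; congr (_ + odflt _ _)%R.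
  apply: eq_pick => y; apply: eq_forallb => a.
  by rewrite !ffunE addrAC (inj_eq (addIr _)).
(* Passing to the coordinates of [b] permutes the samples, which preserves balance. *)
pose relabel b (t : T) : T := [ffun a => s (inl a) (inr b) (t a)].
pose f (t : T) (v : complete_bipartite k.+1 N) :=
  match v with inl a => t a | inr b => free (relabel b t) end.
exists T, f; split.
- by rewrite card_ffun !card_ord expn_gt0.
- move=> t [a|b] [a'|b'] // _; first by have := freeP (relabel b' t) a; rewrite ffunE.
  rewrite sV /= -(inj_eq (@perm_inj _ (s (inl a') (inr b)))) permKV eq_sym.
  by have := freeP (relabel b t) a'; rewrite ffunE.
have shift_inj z : injective (shift z).
  move=> t u /ffunP E; apply/ffunP=> a; have := E a.
  by rewrite !ffunE => /addIr.
case=> [a|b].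
  by apply: (balanced_equivariant shift_inj) => z t; rewrite /= ffunE.
apply: (@balanced_comp T _ free (relabel b)).
  move=> t u /ffunP E; apply/ffunP=> a; have := E a.
  by rewrite !ffunE => /perm_inj.
exact: balanced_equivariant shift_free.
Qed.

(** * Rotations of an initial segment of colors *)

Section Rotation.
Variables (n m c : nat).

Definition rotate_nat (i : nat) := if i < m then (i + c) %% m else i.

Lemma rotate_nat_inj : injective rotate_nat.
Proof.
have m0 : 0 < m -> forall i, (i + c) %% m < m by move=> h i; rewrite ltn_mod.
move=> i j; rewrite /rotate_nat; case: ltnP => im; case: ltnP => jm E //.
- by have/eqP := E; rewrite eqn_modDr !modn_small // => /eqP.
- by move: (m0 (leq_ltn_trans (leq0n i) im) i); lia.
- by move: (m0 (leq_ltn_trans (leq0n j) jm) j); lia.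
Qed.

Hypothesis le_mn : m <= n.
Lemma rotate_nat_lt (i : 'I_n) : rotate_nat i < n.
Proof.
rewrite /rotate_nat; case: (ltnP i m) => // im.
by apply: (leq_trans _ le_mn); rewrite ltn_mod; apply: leq_ltn_trans im.
Qed.

Lemma rotation_inj : injective (fun i : 'I_n => Ordinal (rotate_nat_lt i)).
Proof. by move=> i j [/rotate_nat_inj] /val_inj. Qed.

Definition rotation : 'S_n := perm rotation_inj.

Lemma val_rotation (i : 'I_n) : val (rotation i) = rotate_nat i.
Proof. by rewrite permE. Qed.
End Rotation.

(* Large enough to index all k-tuples of permutations of 'I_j, for each j < 2k. *)
Definition tuples_count k := \sum_(j < 2 * k) #|{ffun 'I_k -> 'S_j}|.

(** Indices past the last tuple fall back on the trivial one, so the same large side serves every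
    [j]. *)
Definition tuple_of k j (b : nat) : {ffun 'I_k -> 'S_j} :=
  nth [ffun=> 1%g] (enum {ffun 'I_k -> 'S_j}) b.

Lemma tuple_of_surj k j (t : {ffun 'I_k -> 'S_j}) :
  j < 2 * k -> exists b : 'I_(tuples_count k), tuple_of k j b = t.
Proof.
move=> jk; pose b := enum_rank t.
have lt_b : b < tuples_count k.
  apply: leq_trans (ltn_ord b) _.
  by rewrite /tuples_count (bigD1 (Ordinal jk)) //= leq_addr.
by exists (Ordinal lt_b); rewrite /tuple_of -enum_val_nth enum_rankK.
Qed.

(** * Covers that block the first colors *)

Section BlockingCover.
Variables (k j : nat).
Hypotheses (j_gt0 : 0 < j) (jk : j < 2 * k).
Let G := complete_bipartite k (tuples_count k).
Let m := minn k j.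

Let le_mj : m <= j. Proof. exact: geq_minr. Qed.

(** If tuple [b] is the packing on the small side, vertex [a] blocks at [b], in transversal [i], the
    color [i] rotated by [a]. For [i < m], the first [m] vertices together block 0, ..., m-1. *)
Definition blocking_matching (a : 'I_k) (b : 'I_(tuples_count k)) : 'S_j :=
  ((tuple_of k j b a)^-1 * rotation a le_mj)%g.

Definition blocking_family (u v : G) : 'S_j :=
  match u, v with
  | inl a, inr b => blocking_matching a b
  | inr b, inl a => (blocking_matching a b)^-1%g
  | _, _ => 1%g
  end.

Lemma blocking_familyV : matching_family blocking_family.
Proof. by case=> ? [] ? /=; rewrite ?invgK ?invg1. Qed.

Lemma blocking_familyP (g : {ffun 'I_k -> 'S_j}) :
  exists b : 'I_(tuples_count k), forall i c : 'I_j, i < m -> c < m ->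
  exists a : 'I_k, blocking_family (inl a) (inr b) (g a i) = c.
Proof.
have [b bP] := tuple_of_surj g jk; exists b => i c im cm.
have m_gt0 : 0 < m := leq_ltn_trans (leq0n i) im.
(* The rotation taking [i] to [c] is by [c - i] modulo [m]. *)
have lt_a : (c + (m - i)) %% m < k.
  by apply: (leq_trans _ (geq_minl k j)); rewrite ltn_mod.
exists (Ordinal lt_a); apply: val_inj.
rewrite /= /blocking_matching bP permM permK val_rotation /rotate_nat im /=.
rewrite modnDmr addnCA subnKC; last exact: ltnW.
by rewrite modnDr modn_small.
Qed.

(** At [b], the first [m] transversals need [m] distinct colors outside the first [m], but only
    [j - m < m] remain. *)
Lemma not_packable_blocking : ~ exists f : G -> 'S_j,
  forall i, proper_selection blocking_family (fun v => f v i).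
Proof.
case=> f fP; have [b bP] := blocking_familyP [ffun a => f (inl a)].
have out (i : 'I_j) : i < m -> ~~ (f (inr b) i < m).
  move=> im; apply/negP => cm; have [a] := bP i (f (inr b) i) im cm.
  by rewrite ffunE => E; have := fP i (inl a) (inr b) isT; rewrite E eqxx.
have cardm : #|[set i : 'I_j | i < m]| = m.
  by rewrite -sum1dep_card (big_ord_narrow le_mj) sum_nat_const card_ord muln1.
have := cardsC [set i : 'I_j | i < m]; rewrite cardm card_ord.
have : #|f (inr b) @: [set i : 'I_j | i < m]| <= #|~: [set i : 'I_j | i < m]|.
  apply: subset_leq_card; apply/subsetP=> _ /imsetP[i + ->].
  by rewrite !inE; apply: out.
rewrite card_imset ?cardm; last exact: perm_inj.
by move: jk j_gt0; rewrite /m; lia.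
Qed.

Lemma no_selection_blocking : j <= k ->
  ~ exists f : G -> 'I_j, proper_selection blocking_family f.
Proof.
move=> le_jk [f fP]; pose i0 := Ordinal j_gt0.
(* The transpositions place the single selection at transversal 0, where all [m = j] colors are
   blocked. *)
have [b bP] := blocking_familyP [ffun a => tperm i0 (f (inl a))].
have mj : m = j by apply/minn_idPr.
have [||a] := bP i0 (f (inr b)); rewrite ?mj ?ltn_ord // ffunE tpermL => E.
by have := fP (inl a) (inr b) isT; rewrite E eqxx.
Qed.
End BlockingCover.

Lemma correspondence_packing_gap k : 2 <= k ->
  exists G : sgraph, fractional_correspondence_packing_number G (k + 1) /\
    correspondence_packing_number G (2 * k).
Proof.
case: k => [|[|k]] // _; set K := k.+2.
pose G := complete_bipartite K (tuples_count K).
have v : G by left; exact: ord0.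
exists G; split; split.
- split=> [|H L coverL]; first by rewrite addn1.
  rewrite addn1 in coverL *.
  apply: (fractionally_packable_fractional coverL v).
  exact: fractionally_packable_bipartite.
- move=> j [j_gt0 jP]; rewrite addn1 ltnNge; apply/negP => le_jk.
  have jk : j < 2 * K by rewrite /K in le_jk *; lia.
  apply: (no_selection_blocking j_gt0 jk le_jk).
  apply: (perm_cover_fractional (sV := @blocking_familyV K j) j_gt0).
  exact: jP (perm_cover_fold _).
- split=> // H L coverL; apply: (colorable_chromatic coverL v).
  apply: (packable_colorable coverL).
  exact: complete_bipartite_packable.
- move=> j [j_gt0 jP]; rewrite leqNgt; apply/negP => jk.
  apply: (not_packable_blocking j_gt0 jk).
  apply: (perm_cover_colorable (sV := @blocking_familyV K j)).
  by have [] := jP _ _ (perm_cover_fold (@blocking_familyV K j)).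
Qed.

(** * A cubic necklace *)

(* Two copies, indexed by i, of K_4 minus an edge: the vertex (i, m, j) is an
   endpoint of the missing edge if m = false, and those are joined across the
   two copies. *)
Definition necklace_edge : rel (bool * bool * bool)%type := fun x y =>
  let: (i, m, j) := x in let: (i', m', j') := y in
  if i == i' then (m || m') && ((m, j) != (m', j'))
  else [&& ~~ m, ~~ m' & j == j'].

Fact necklace_sym : symmetric necklace_edge.
Proof. by move=> [[[] []] []] [[[] []] []]. Qed.

Fact necklace_irrefl : irreflexive necklace_edge.
Proof. by move=> [[[] []] []]. Qed.

Definition necklace : sgraph := SGraph necklace_sym necklace_irrefl.

Lemma necklace_regular : regular necklace 3.
Proof.
move=> x; pose nbrs (x : bool * bool * bool) := let: (i, m, j) := x in
  if m then [:: (i, true, ~~ j); (i, false, true); (i, false, false)]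
  else [:: (~~ i, false, j); (i, true, true); (i, true, false)].
rewrite /degree (_ : #|_| = #|nbrs x|).
  by rewrite (card_uniqP _); case: x => [[[] []] []].
apply: eq_card => y; rewrite inE.
by case: x => [[[] []] []]; case: y => [[[] []] []].
Qed.

Lemma necklace_connected : connected necklace.
Proof.
have sym : connect_sym (@edge necklace).
  by apply: sym_connect_sym; apply: edge_sym.
have hub i m j : connect (@edge necklace) (i, true, false) (i, m, j).
  by case: m; case: j; rewrite ?connect0 //; apply: connect1; case: i.
have mid : connect (@edge necklace) (true, true, false) (false, true, false).
  apply: connect_trans (hub true false false) _; rewrite sym.
  apply: connect_trans (hub false false false) _; exact: connect1.
split; first by apply/card_gt0P; exists (true, true, true).
have from_hub x : connect (@edge necklace) (true, true, false) x.
  case: x => [[[] m] j]; first exact: hub.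
  exact: connect_trans mid (hub _ _ _).
by move=> x y; apply: connect_trans (from_hub y); rewrite sym.
Qed.

Lemma necklace_not_K4 : ~ isomorphic necklace (complete_graph 4).
Proof.
case=> f /bij_eq_card + _; rewrite /= !card_prod card_bool card_ord.
by [].
Qed.

Lemma necklace_packable : packable necklace 6.
Proof.
apply: (@greedy_packing necklace (fun x => enum_rank x) 3).
  move=> u v; apply: contraTneq => /val_inj/enum_rank_inj ->.
  by rewrite edge_irrefl.
move=> v; rewrite -(necklace_regular v); apply: subset_leq_card.
by apply/subsetP=> u; rewrite !inE edge_sym => /andP[].
Qed.

Lemma necklace_triangle (a b : 'I_3) : a != b ->
  let q (a : 'I_3) : necklace := nth (true, false, false)
    [:: (true, false, false); (true, true, false); (true, true, true)] a in
  edge (q a) (q b).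
Proof. by case: a => [[|[|[|?]]] ?]; case: b => [[|[|[|?]]] ?]. Qed.

(** * Fractional packing with four colors *)

Section FourFold.

(** The options are 1 and -1, with 2 replacing the one equal to [w], if any. They differ from each
    other, from 0 and from [w]. *)
Definition avoid_offset (w : 'I_4) (n : bool) : 'I_4 :=
  (if n then if w == 1 then 1 + 1 else 1 else if w == -1 then 1 + 1 else -1)%R.

(** Apart from the summand [u], only [v - u] enters, so shifting both colors shifts the options. *)
Definition avoid (u v : 'I_4) (n : bool) : 'I_4 :=
  (u + avoid_offset (v - u) n)%R.

Lemma avoid_neq_l u v n : avoid u v n != u.
Proof.
rewrite /avoid -subr_eq0 addrAC subrr add0r.
by case: (v - u)%R n => [[|[|[|[|?]]]] ?] [].
Qed.

Lemma avoid_neq_r u v n : avoid u v n != v.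
Proof.
rewrite /avoid -(inj_eq (addrI (- u)%R)) addKr [(- u + v)%R]addrC.
by case: (v - u)%R n => [[|[|[|[|?]]]] ?] [].
Qed.

Lemma avoid_inj u v : injective (avoid u v).
Proof.
move=> n n' /addrI; case: (v - u)%R => [[|[|[|[|?]]]] ?] //;
  by case: n; case: n' => // /eqP.
Qed.

Definition swap_coin (r : 'S_4) (a b : bool -> 'I_4) : bool :=
  [exists n, r (a n) == b n].

(* A perfect matching between the two options a and the two options b along
   which no pair is in conflict. *)
Lemma swap_coinP (r : 'S_4) (a b : bool -> 'I_4) n :
  injective a -> injective b -> r (a n) != b (n (+) swap_coin r a b).
Proof.
move=> a_inj b_inj; rewrite /swap_coin; case: existsP => [[n0 /eqP E]|none].
  (* After a conflict between equal options at [n0], crossed ones cannot conflict: at [n0] by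
     injectivity of [b], at the other option by injectivity of [r] and [a]. *)
  rewrite addbT; apply/eqP => E'; have [nn0|nn0] := eqVneq n n0.
    by have := b_inj n0 (~~ n); rewrite -E -E' nn0 => /(_ erefl); case: (n0).
  have En : n0 = ~~ n by move: nn0; case: (n); case: (n0).
  by case/eqP: nn0; apply/a_inj/(@perm_inj _ r); rewrite E' E En.
by rewrite addbF; apply/negP => E; apply: none; exists n.
Qed.

(** The colors of the two endpoints in copy [true], a coin for that copy and a coin for the
    other. *)
Let sample : finType := ('I_4 * 'I_4 * bool * bool)%type.

(** The correction [g x y] depends only on the colors, so [h] permutes the samples; what remains is
    [avoid], equivariant under shifts. *)
Lemma balanced_avoid (P Q : 'I_4 -> 'I_4) (g : 'I_4 -> 'I_4 -> bool) (i : bool) :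
  injective P -> injective Q ->
  balanced (fun t : sample => let: (x, y, n, n') := t in
    avoid (P x) (Q y) ((if i then n else n') (+) g x y)).
Proof.
move=> P_inj Q_inj.
pose h (t : sample) : sample := let: (x, y, n, n') := t in
  (P x, Q y, (if i then n else n') (+) g x y, if i then n' else n).
have h_inj : injective h.
  move=> [[[x y] n] n'] [[[x' y'] m] m'] [/P_inj-> /Q_inj->].
  by rewrite /h; case: (i) => /addIb -> ->.
pose F (t : sample) := let: (u, v, n, _) := t in avoid u v n.
have E : balanced (F \o h).
  apply: balanced_comp => //.
  pose sh a (t : sample) : sample := let: (u, v, n, n') := t in
    (u + a, v + a, n, n')%R.
  apply: (@balanced_equivariant _ _ _ sh) => [a|a [[[u v] n] n']].
    move=> [[[x y] n] n'] [[[x' y'] m] m'] /eqP.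
    by rewrite !xpair_eqE !(inj_eq (addIr a)) -!xpair_eqE => /eqP.
  by rewrite /= /avoid opprD addrACA subrr addr0 addrAC.
move=> a b; have := E a b.
by congr (_ = _); apply: eq_card => -[[[x y] n] n']; rewrite !inE.
Qed.

Lemma balanced_fst (P : 'I_4 -> 'I_4) : injective P ->
  balanced (fun t : sample => P t.1.1.1) /\ balanced (fun t : sample => P t.1.1.2).
Proof.
move=> P_inj; have F : balanced (fun t : sample => t.1.1.1).
  apply: (@balanced_equivariant _ _ _ (fun a (t : sample) =>
    ((t.1.1.1 + a)%R, t.1.1.2, t.1.2, t.2))) => // a.
  move=> [[[x y] n] n'] [[[x' y'] m] m'] /eqP.
  by rewrite !xpair_eqE (inj_eq (addIr a)) -!xpair_eqE => /eqP.
split.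
  apply: (@balanced_comp _ _ _ (fun t : sample =>
    (P t.1.1.1, t.1.1.2, t.1.2, t.2)) _ F).
  by move=> [[[x y] n] n'] [[[x' y'] m] m'] [/P_inj-> -> -> ->].
apply: (@balanced_comp _ _ _ (fun t : sample =>
  (P t.1.1.2, t.1.1.1, t.1.2, t.2)) _ F).
by move=> [[[x y] n] n'] [[[x' y'] m] m'] [/P_inj-> -> -> ->].
Qed.

Lemma necklace_fractionally_packable : fractionally_packable necklace 4.
Proof.
move=> s sV.
pose e (i j : bool) : necklace := (i, false, j).
pose c (i j : bool) : necklace := (i, true, j).
(* In copy [false], adding 1 to the matched color avoids the conflict along the linking edge and
   keeps the color uniform. *)
pose X i j (x : 'I_4) := if i then x else (s (e true j) (e false j) x + 1)%R.
have X_inj i j : injective (X i j).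
  by case: i => // x y /addIr /perm_inj.
pose opt i j x y := avoid (s (e i false) (c i j) (X i false x))
                          (s (e i true) (c i j) (X i true y)).
(* The coin is reversed at one middle vertex, [j = true], when some pair of equal options
   conflicts. *)
pose sw i x y :=
  swap_coin (s (c i false) (c i true)) (opt i false x y) (opt i true x y).
pose f (t : sample) (v : necklace) : 'I_4 :=
  let: (x, y, n, n') := t in let: (i, m, j) := v in
  if m then opt i j x y ((if i then n else n') (+) (j && sw i x y))
  else X i j (if j then y else x).
have rev (u v : necklace) a b : s u v a != b -> s v u b != a.
  by move=> ab; rewrite (sV u v) -(inj_eq (@perm_inj _ (s u v))) permKV eq_sym.
have mid t i : s (c i false) (c i true) (f t (c i false)) != f t (c i true).
  case: t => [[[x y] n] n'] /=; rewrite addbF.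
  exact: swap_coinP (@avoid_inj _ _) (@avoid_inj _ _).
have spoke t i j j' : s (e i j') (c i j) (f t (e i j')) != f t (c i j).
  case: t => [[[x y] n] n'] /=; rewrite eq_sym.
  by case: j' => /=; [apply: avoid_neq_r | apply: avoid_neq_l].
have link t j : s (e true j) (e false j) (f t (e true j)) != f t (e false j).
  case: t => [[[x y] n] n'] /=; rewrite /X.
  by rewrite -subr_eq0 opprD addrA subrr sub0r oppr_eq0.
exists sample, f; split.
- by apply/card_gt0P; exists (ord0, ord0, true, true).
- move=> t [[i m] j] [[i' m'] j']; rewrite /edge /=.
  have [<-{i'}|ii'] := eqVneq i i'.
    case: m; case: m' => //= jj'; last first.
    + exact: spoke.
    + by apply: rev; apply: spoke.
    + by case: j j' jj' => -[] // _; [apply: rev|]; apply: mid.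
  case: m; case: m' => //= /eqP<-{j'}.
  by case: i i' ii' => -[] // _; [|apply: rev]; apply: link.
- move=> [[i m] j]; case: m.
    have := @balanced_avoid
      (fun x => s (e i false) (c i j) (X i false x))
      (fun y => s (e i true) (c i j) (X i true y))
      (fun x y => j && sw i x y) i.
    move=> /(_ (inj_comp perm_inj (X_inj _ _)) (inj_comp perm_inj (X_inj _ _))).
    move=> E a b; have := E a b.
    by congr (_ = _); apply: eq_card => -[[[x y] n] n']; rewrite !inE.
  have [F1 F2] := balanced_fst (X_inj i j).
  case: j F1 F2 => F1 F2 a b; [have := F2 a b|have := F1 a b];
    by congr (_ = _); apply: eq_card => -[[[x y] n] n']; rewrite !inE.
Qed.

End FourFold.

(** * A list assignment that excludes three colors *)

Section ThreeFold.

Definition necklace_vertices : seq (bool * bool * bool) :=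
  [seq (p, j) | p <- [seq (i, m) | i <- [:: true; false], m <- [:: true; false]],
                j <- [:: true; false]].

Definition necklace_list (v : bool * bool * bool) : seq nat :=
  let: (i, m, j) := v in
  if ~~ i && m then [:: 0; 1; 2] else if j then [:: 0; 1; 3] else [:: 1; 2; 3].

(* An integral dual certificate: the weights of all listed colors add up to 10,
   whereas a proper coloring only collects 3. *)
Definition necklace_weight (v : bool * bool * bool) (c : nat) : nat :=
  let: (i, m, j) := v in
  if i then if m then (c == 1) + 2 * (c == 3) else c == 3
  else ~~ m && ((c == 0) || (c == 2)).

Definition lookup (cs : seq nat) v := nth 0 cs (index v necklace_vertices).

Definition assignments (vs : seq (bool * bool * bool)) : seq (seq nat) :=
  foldr (fun v css => [seq c :: cs | c <- necklace_list v, cs <- css]) [:: [::]] vs.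

Lemma mem_assignments vs (g : bool * bool * bool -> nat) :
  (forall v, g v \in necklace_list v) -> [seq g v | v <- vs] \in assignments vs.
Proof. by move=> gL; elim: vs => //= v vs IH; apply: allpairs_f. Qed.

(** All 3^8 choices from the lists are enumerated and checked by evaluation. *)
Lemma necklace_weight_computed : all (fun cs =>
   all (fun u => all (fun v => necklace_edge u v ==> (lookup cs u != lookup cs v))
     necklace_vertices) necklace_vertices ==>
   (\sum_(v <- necklace_vertices) necklace_weight v (lookup cs v) <= 3))
  (assignments necklace_vertices).
Proof. by rewrite unlock; vm_compute. Qed.

Lemma necklace_weight_le (g : bool * bool * bool -> nat) :
  (forall v, g v \in necklace_list v) ->
  (forall u v, necklace_edge u v -> g u != g v) ->
  \sum_v necklace_weight v (g v) <= 3.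
Proof.
move=> gL gE; have all_v v : v \in necklace_vertices by case: v => [[[] []] []].
have lookupE v : lookup [seq g v | v <- necklace_vertices] v = g v.
  by rewrite /lookup (nth_map v) ?nth_index // index_mem.
rewrite (perm_big necklace_vertices) /=; last first.
  by apply: uniq_perm; rewrite ?index_enum_uniq // => v; rewrite mem_index_enum all_v.
have /allP/(_ _ (mem_assignments necklace_vertices gL))/implyP :=
  necklace_weight_computed.
rewrite (eq_bigr (fun v => necklace_weight v (g v))) => [|v _]; last by rewrite lookupE.
apply; apply/allP => u _; apply/allP => v _; apply/implyP.
by rewrite !lookupE; apply: gE.
Qed.

Lemma necklace_list_assignment :
  list_assignment 3 (fun v : necklace => seq_list (necklace_list v)).
Proof. by move=> [[i m] j]; rewrite card_seq_list; case: i; case: m; case: j. Qed.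

(** Each listed color has mass 1, so the collected weight is 10, whereas total mass 3 and at most 3
    per coloring allow only 9. *)
Lemma necklace_not_uniform :
  ~ fractional_chromatic_number
      (list_cover (fun v : necklace => seq_list (necklace_list v))) 3%:R%R.
Proof.
case/(fractional_list_colorings necklace_list_assignment (true, true, true)).
move=> T [p [f [p_gt0 fL fE fp]]].
have fS t v : f t v \in necklace_list v by rewrite -mem_seq_list.
have le3 t : \sum_v necklace_weight v (f t v) <= 3.
  by apply: necklace_weight_le; [exact: fS|exact: fE].
have part v (y : nat -> nat) :
    (\sum_t p t * (y (f t v))%:R = (\sum_(c <- necklace_list v) y c)%:R)%R.
  have L_uniq : uniq (necklace_list v) by case: v => [[[] []] []].
  transitivity (\sum_(c <- necklace_list v)
      \sum_(t | f t v == c) p t * (y (f t v))%:R)%R.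
    rewrite (exchange_big_dep xpredT) //=; apply: eq_bigr => t _.
    rewrite -big_filter (_ : [seq c <- _ | _] = [:: f t v]) ?big_seq1 //.
    apply: perm_small_eq => //; apply: uniq_perm; rewrite ?filter_uniq // => c.
    rewrite mem_filter mem_seq1; apply/andP/eqP => [[/eqP-> //]|->].
    by split; [exact: eqxx|exact: fS].
  rewrite natr_sum; apply: eq_big_seq => c cv.
  rewrite (eq_bigr (fun t => p t * (y c)%:R)%R) => [|t /eqP-> //].
  by rewrite -mulr_suml fp ?mul1r // mem_seq_list.
have mass : (\sum_t p t = 3%:R)%R.
  have := part (true, true, true) (fun=> 1).
  by rewrite sum1_size; under eq_bigr do rewrite mulr1.
have : (\sum_t p t * (\sum_v necklace_weight v (f t v))%:R <= 3%:R * 3%:R)%R.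
  rewrite -{1}mass mulr_suml; apply: ler_sum => t _.
  by rewrite ler_wpM2l ?ler_nat // ltW.
have -> : (\sum_t p t * (\sum_v necklace_weight v (f t v))%:R = 10%:R)%R.
  transitivity (\sum_(v : necklace) (\sum_(c <- necklace_list v) necklace_weight v c)%:R : rat)%R.
    under [RHS]eq_bigr => v _ do rewrite -(part v (necklace_weight v)).
    rewrite exchange_big /=; apply: eq_bigr => t _.
    by rewrite natr_sum mulr_sumr.
  rewrite -natr_sum (perm_big necklace_vertices) /=; last first.
    apply: uniq_perm; rewrite ?index_enum_uniq // => v.
    by rewrite mem_index_enum; case: v => [[[] []] []].
  by rewrite unlock.
by rewrite -natrM ler_nat.
Qed.

End ThreeFold.

Lemma cubic_fractional_list_packing : exists G : sgraph,
  [/\ connected G, regular G 3, ~ isomorphic G (complete_graph 4),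
      fractional_list_packing_number G 4 &
      exists2 m : nat, list_packing_number G m & 4 <= m].
Proof.
have v : necklace by exact: (true, true, true).
(* The triangle excludes fewer than three colors, the list assignment above exactly three. *)
have least4 j : (0 < j /\ forall L : necklace -> {fset nat}, list_assignment j L ->
    fractional_chromatic_number (list_cover L) j%:R%R) -> 4 <= j.
  case=> j_gt0 jL; have := clique_fractional_list necklace_triangle j_gt0 jL.
  rewrite leq_eqVlt => /orP[/eqP j3|//]; case: necklace_not_uniform.
  by move: jL; rewrite -j3; apply; apply: necklace_list_assignment.
exists necklace; split.
- exact: necklace_connected.
- exact: necklace_regular.
- exact: necklace_not_K4.
- split; last exact: least4.
  split=> // L /list_cover_fold fold.
  exact: (fractionally_packable_fractional fold v necklace_fractionally_packable).
- have [m mP] : exists m, list_packing_number necklace m.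
    by apply: (@least_exists _ 6); apply: (packable_list_packing v _ necklace_packable).
  exists m => //; apply: least4; apply: (list_packing_fractional v).
  by have [] := mP.
Qed.

Theorem theorem9 :
  (forall d : nat, 2 <= d ->
     exists G : sgraph, degeneracy G d /\
       exists2 m : nat, fractional_list_packing_number G m & d + 2 <= m) /\
  (forall k : nat, 2 <= k ->
     exists G : sgraph, fractional_correspondence_packing_number G (k + 1) /\
       correspondence_packing_number G (2 * k)) /\
  (exists G : sgraph,
     [/\ connected G, regular G 3, ~ isomorphic G (complete_graph 4),
         fractional_list_packing_number G 4 &
         exists2 m : nat, list_packing_number G m & 4 <= m]).
Proof.
split; first exact: degenerate_list_packing.
split; first exact: correspondence_packing_gap.
exact: cubic_fractional_list_packing.
Qed.
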